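(* Let $S$ be a finitely presented semigroup and let $s\in S$ be such that the $\mathscr R$-class $R_s$ of $s$ has only finitely many $\mathscr H$-classes and $\mathrm{St}(s)=\mathrm{St}(e)$ for some idempotent $e\in S$. Then the Schützenberger group of $R_s$ is finitely presented. Moreover, the hypothesis that $\mathrm{St}(s)=\mathrm{St}(e)$ for some idempotent $e\in S$ holds in particular if $s$ is regular or, more generally, if the $\mathscr L^*$-class of $s$ contains an idempotent.
   Context: $S^1$ denotes $S$ with an identity adjoined. Green's relations: $s\mathrel{\mathscr R}t$ iff $sS^1=tS^1$; $s\mathrel{\mathscr L}t$ iff $S^1s=S^1t$; $\mathscr H=\mathscr L\cap\mathscr R$. For $s\in S$, the right stabilizer is $\mathrm{St}(s)=\{t\in S\mid st=s\}$. Define $s\mathrel{\mathscr L^*}t$ if for all $x,y\in S^1$ one has $sx=sy$ if and only if $tx=ty$. An element $s$ is regular if $sts=s$ for some $t\in S$. For an $\mathscr R$-class $R$, let $\mathrm{St}(R)=\{s\in S^1\mid sR\subseteq R\}$, acting on $R$ by left multiplication. The quotient of $\mathrm{St}(R)$ by its action on $R$ (identify $s,t\in\mathrm{St}(R)$ when $sr=tr$ for all $r\in R$) is a group $G(R)$, called the Schützenberger group of $R$; its orbits on $R$ are exactly the $\mathscr H$-classes contained in $R$. *)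

(* Defs.v *)
From HB Require Import structures.
From mathcomp Require Import all_boot monoid generic_quotient.
From mathcomp Require Import boolp classical_sets cardinality.

Set Implicit Arguments.
Unset Strict Implicit.
Unset Printing Implicit Defensive.

Local Open Scope classical_set_scope.
Local Open Scope group_scope.

(* S^1: an identity [None] is adjoined even if S already has one; every notion
   below is insensitive to this choice. *)
Definition adj1 (S : semigroupType) : Type := option S.
Definition in1 (S : semigroupType) (s : S) : adj1 S := Some s.

Section AdjoinIdentity.
Variable S : semigroupType.

Definition adj1_mul (u v : adj1 S) : adj1 S :=
  match u, v with
  | Some a, Some b => Some (a * b)
  | Some _, None => u
  | None, _ => v
  end.

Fact adj1_mulA : associative adj1_mul.
Proof. by case=> [a|] [b|] [c|] //=; rewrite mulgA. Qed.
Fact adj1_mul1 : left_id (None : adj1 S) adj1_mul.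
Proof. by case. Qed.
Fact adj1_mulr1 : right_id (None : adj1 S) adj1_mul.
Proof. by case. Qed.

HB.instance Definition _ := Choice.copy (adj1 S) (option S).
HB.instance Definition _ :=
  isMonoid.Build (adj1 S) adj1_mulA adj1_mul1 adj1_mulr1.

Fact in1_morph : {morph @in1 S : x y / x * y}.
Proof. by []. Qed.
HB.instance Definition _ := isMultiplicative.Build S (adj1 S) (@in1 S) in1_morph.

Lemma in1_inj : injective (@in1 S).
Proof. by move=> x y []. Qed.

End AdjoinIdentity.

Section Green.
Variable S : semigroupType.
Implicit Types s t e : S.

Definition greenR s t : Prop :=
  [set in1 s * u | u in [set: adj1 S]] = [set in1 t * u | u in [set: adj1 S]].
Definition greenL s t : Prop :=
  [set u * in1 s | u in [set: adj1 S]] = [set u * in1 t | u in [set: adj1 S]].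
Definition greenH s t : Prop := greenL s t /\ greenR s t.

Definition Rclass s : set S := [set t | greenR s t].
Definition Hclass s : set S := [set t | greenH s t].
Definition Hclasses (R : set S) : set (set S) := [set Hclass r | r in R].

Definition rstab s : set S := [set t | s * t = s].

Definition Lstar s t : Prop :=
  forall x y : adj1 S, in1 s * x = in1 s * y <-> in1 t * x = in1 t * y.

Lemma greenRP s t :
  greenR s t <-> (exists u, in1 s * u = in1 t) /\ (exists v, in1 t * v = in1 s).
Proof.
split=> [st | [[u su] [v tv]]].
  split.
    have: [set in1 t * w | w in [set: adj1 S]] (in1 t) by exists 1; rewrite ?mulg1.
    by rewrite -st => -[u _ su]; exists u.
  have: [set in1 s * w | w in [set: adj1 S]] (in1 s) by exists 1; rewrite ?mulg1.
  by rewrite st => -[v _ tv]; exists v.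
apply/seteqP; split=> _ [w _ <-].
  by exists (v * w) => //; rewrite mulgA tv.
by exists (u * w) => //; rewrite mulgA su.
Qed.

Definition is_idempotent e : Prop := e * e = e.
Definition is_regular s : Prop := exists t, s * t * s = s.

End Green.

Definition St (S : semigroupType) (R : set S) : set (adj1 S) :=
  [set u | [set u * in1 r | r in R] `<=` [set in1 r | r in R]].

Definition St_type (S : semigroupType) (R : set S) : Type :=
  {u : adj1 S | u \in St R}.

Section SchutzenbergerMonoid.
Variables (S : semigroupType) (R : set S).

HB.instance Definition _ := [isSub of St_type R for @sval _ _].
HB.instance Definition _ := [Choice of St_type R by <:].

Fact St_closed : monoid_closed (fun u : adj1 S => u \in St R).
Proof.
split; first by rewrite -topredE /= inE => _ [r Rr <-]; exists r; rewrite ?mul1g.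
move=> u v; rewrite -!topredE /= !inE => uR vR _ [r Rr <-].
have [r' Rr' vE] : [set in1 r | r in R] (v * in1 r) by apply: vR; exists r.
by rewrite -mulgA -vE; apply: uR; exists r'.
Qed.

HB.instance Definition _ :=
  SubChoice_isSubMonoid.Build (adj1 S) _ (St_type R) St_closed.

Definition same_action (u v : St_type R) : bool :=
  `[< forall r, R r -> val u * in1 r = val v * in1 r >].

Fact same_action_refl : reflexive same_action.
Proof. by move=> u; apply/asboolP. Qed.
Fact same_action_sym : symmetric same_action.
Proof. by move=> u v; apply/asboolP/asboolP => uv r Rr; rewrite uv. Qed.
Fact same_action_trans : transitive same_action.
Proof.
by move=> v u w /asboolP uv /asboolP vw; apply/asboolP => r Rr; rewrite uv ?vw.
Qed.

Canonical same_action_equiv :=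
  EquivRel same_action same_action_refl same_action_sym same_action_trans.

Definition schutz_monoid : Type := {eq_quot same_action}%qT.
HB.instance Definition _ := Choice.on schutz_monoid.
HB.instance Definition _ := EqQuotient.on schutz_monoid.

Local Open Scope quotient_scope.

Definition schutz_mul (x y : schutz_monoid) : schutz_monoid :=
  \pi_schutz_monoid (repr x * repr y).
Definition schutz_one : schutz_monoid := \pi_schutz_monoid (1 : St_type R).

Lemma schutz_piP (u v : St_type R) :
  \pi_schutz_monoid u = \pi_schutz_monoid v <->
  forall r, R r -> val u * in1 r = val v * in1 r.
Proof.
split; first by move/eqquotP/asboolP.
by move=> uv; apply/eqquotP/asboolP.
Qed.

Lemma schutz_piM (u v : St_type R) :
  schutz_mul (\pi_schutz_monoid u) (\pi_schutz_monoid v) =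
  \pi_schutz_monoid (u * v).
Proof.
have reprE w r : R r -> val (repr (\pi_schutz_monoid w)) * in1 r = val w * in1 r.
  by move: r; apply/schutz_piP; rewrite reprK.
apply/schutz_piP => r Rr; rewrite !valM -!mulgA reprE //.
have vR : St R (val v) by apply/set_mem; exact: (valP v).
have [|r' Rr' <-] := vR (val v * in1 r); first by exists r.
exact: reprE.
Qed.

Fact schutz_mulA : associative schutz_mul.
Proof.
move=> x y z; rewrite -[x]reprK -[y]reprK -[z]reprK.
move: (repr x) (repr y) (repr z) => u v w.
by rewrite (schutz_piM v w) (schutz_piM u v) (schutz_piM u) schutz_piM mulgA.
Qed.
Fact schutz_mul1 : left_id schutz_one schutz_mul.
Proof. by move=> x; rewrite -[x]reprK schutz_piM mul1g. Qed.
Fact schutz_mulr1 : right_id schutz_one schutz_mul.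
Proof. by move=> x; rewrite -[x]reprK schutz_piM mulg1. Qed.

HB.instance Definition _ :=
  isMonoid.Build schutz_monoid schutz_mulA schutz_mul1 schutz_mulr1.

End SchutzenbergerMonoid.

(* Without the finiteness assumption the quotient need not be a group: for the
   R-class of 1 in the bicyclic monoid it is the additive monoid of naturals. *)
Section SchutzenbergerGroup.
Variables (S : semigroupType) (s : S).
Hypothesis fin : finite_set (Hclasses (Rclass s)).

Local Open Scope quotient_scope.

Fact schutz_left_inverse (x : schutz_monoid (Rclass s)) :
  exists y : schutz_monoid (Rclass s), y * x = 1.
Proof.
pose R := Rclass s; have Rs : R s by [].
have Req r r' : R r -> R r' -> greenR r r' by rewrite /R /Rclass /= /greenR => <-.
rewrite -[x]reprK; move: (repr x) => u {x}.
have StR (w : St_type R) r : R r -> exists2 r', R r' & in1 r' = val w * in1 r.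
  move=> Rr; have wR : St R (val w) by apply/set_mem; exact: (valP w).
  by have [|r' Rr' <-] := wR (val w * in1 r); [exists r | exists r'].
pose sn n := projT1 (cid2 (StR (u ^+ n) s Rs)).
have Rsn n : R (sn n) by rewrite /sn; case: cid2.
have snE n : in1 (sn n) = val (u ^+ n) * in1 s by rewrite /sn; case: cid2.
have [i [k [t tE]]] : exists i k t, t * (val (u ^+ k.+1) * in1 (sn i)) = in1 (sn i).
  have [i [j [ltij Hij]]] : exists i j, (i < j)%N /\ Hclass (sn i) = Hclass (sn j).
    apply: contrapT => noij; apply: infinite_nat.
    have -> : [set: nat] = (fun n => Hclass (sn n)) @^-1` Hclasses R.
      by apply/seteqP; split=> // n _; exists (sn n).
    apply: finite_preimage fin => i j _ _ Hij; case: (ltngtP i j) => // ltij.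
      by case: noij; exists i, j.
    by case: noij; exists j, i.
  have : Hclass (sn j) (sn i) by rewrite -Hij; split.
  case=> [Lij _]; exists i, (j - i.+1)%N.
  have : [set w * in1 (sn i) | w in [set: adj1 S]] (in1 (sn i)).
    by exists 1; rewrite ?mul1g.
  rewrite -Lij => -[t _ tE]; exists t.
  by rewrite snE [X in t * X]mulgA -valM -expgnDr -subSn // subSS subnK ?(ltnW ltij) // -!snE.
have tK r : R r -> t * (val (u ^+ k.+1) * in1 r) = in1 r.
  move=> Rr; have [[v <-] _] := (greenRP _ _).1 (Req _ _ (Rsn i) Rr).
  by rewrite [X in t * X]mulgA mulgA tE.
have tSt : t \in St R.
  apply/mem_set => _ [r Rr <-].
  have [r' Rr' r'E] := StR (u ^+ k.+1) r Rr.
  have [[v rv] [v' r'v]] := (greenRP _ _).1 (Req _ _ Rr Rr').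
  have tr : t * in1 r = in1 r * v' by rewrite -{1}r'v r'E mulgA tK.
  have trv : in1 r * v' * v = in1 r by rewrite -tr -mulgA rv r'E tK.
  rewrite tr; clear tr; case: v' r'v trv => [a|] r'v trv; last first.
    by exists r => //; rewrite mulg1.
  exists (r * a) => //; suff: greenR r (r * a) by move=> ra; exact: etrans Rr ra.
  by apply/greenRP; split; [exists (in1 a) | exists v].
exists (\pi_(schutz_monoid R) ((Sub t tSt : St_type R) * u ^+ k)).
rewrite [LHS](schutz_piM _ u); apply/schutz_piP => r Rr.
rewrite -(mulgA (Sub t tSt : St_type R)) -expgSr valM SubK val1 mul1g.
by rewrite -mulgA tK.
Qed.

Definition schutz_group & finite_set (Hclasses (Rclass s)) : Type :=
  schutz_monoid (Rclass s).
Local Notation G := (schutz_group fin).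
HB.instance Definition _ := Monoid.on G.

Definition schutz_inv (x : G) : G := projT1 (cid (schutz_left_inverse x)).

Fact schutz_mulVg : left_inverse 1 schutz_inv (@mul G).
Proof. by move=> x; rewrite /schutz_inv; case: cid. Qed.
Fact schutz_mulgV : right_inverse 1 schutz_inv (@mul G).
Proof.
move=> x; rewrite -[LHS]mul1g -{1}(schutz_mulVg (schutz_inv x)) -mulgA.
by rewrite [schutz_inv x * (_ * _)]mulgA schutz_mulVg mul1g schutz_mulVg.
Qed.

HB.instance Definition _ := hasInv.Build G schutz_inv.
HB.instance Definition _ := Monoid_isGroup.Build G schutz_mulVg schutz_mulgV.

End SchutzenbergerGroup.

Definition free_monoid (A : choiceType) : Type := seq A.

Section FreeMonoid.
Variable A : choiceType.
HB.instance Definition _ := Choice.copy (free_monoid A) (seq A).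
HB.instance Definition _ := isMonoid.Build (free_monoid A)
  (@catA A) (@cat0s A) (@cats0 A).
End FreeMonoid.

Definition free_semigroup (A : choiceType) : Type :=
  {w : free_monoid A | w != 1}.

Section FreeSemigroup.
Variable A : choiceType.
HB.instance Definition _ := [isSub of free_semigroup A for @sval _ _].
HB.instance Definition _ := [Choice of free_semigroup A by <:].
Fact free_semigroup_closed : mulg_closed (fun w : free_monoid A => w != 1).
Proof. by case=> [|a u] [|b v]. Qed.
HB.instance Definition _ := SubChoice_isSubSemigroup.Build
  (free_monoid A) _ (free_semigroup A) free_semigroup_closed.
End FreeSemigroup.

Inductive congr_gen (F : semigroupType) (E : F -> F -> Prop) : F -> F -> Prop :=
| congr_base u v : E u v -> congr_gen E u v
| congr_refl u : congr_gen E u u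
| congr_sym u v : congr_gen E u v -> congr_gen E v u
| congr_trans u v w : congr_gen E u v -> congr_gen E v w -> congr_gen E u w
| congr_mul u u' v v' :
    congr_gen E u u' -> congr_gen E v v' -> congr_gen E (u * v) (u' * v').

(* f induces an isomorphism from F / congr_gen E onto T. *)
Definition presents (F T : semigroupType) (E : F -> F -> Prop)
    (f : {multiplicative F -> T}) : Prop :=
  (forall x, exists w, f w = x) /\
  (forall u v, f u = f v <-> congr_gen E u v).

Definition fin_presented_semigroup (S : semigroupType) : Prop :=
  exists (n : nat) (E : seq (free_semigroup 'I_n * free_semigroup 'I_n))
         (f : {multiplicative free_semigroup 'I_n -> S}),
    presents (fun u v => (u, v) \in E) f.

(* Words over the generators and their formal inverses: [(i, true)] stands for
   the i-th generator and [(i, false)] for its inverse. *)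
Definition group_word (n : nat) : Type := free_monoid ('I_n * bool)%type.
HB.instance Definition _ n := Monoid.on (group_word n).

Inductive free_cancel (n : nat) : group_word n -> group_word n -> Prop :=
| FreeCancel i b : free_cancel ([:: (i, b); (i, ~~ b)] : group_word n) 1.

Definition fin_presented_group (G : groupType) : Prop :=
  exists (n : nat) (E : seq (group_word n * group_word n))
         (f : {multiplicative group_word n -> G}),
    presents (fun u v => (u, v) \in E \/ free_cancel u v) f.

(* Main.v *)
Require Import Defs.
From HB Require Import structures.
From mathcomp Require Import all_boot monoid generic_quotient.
From mathcomp Require Import boolp classical_sets cardinality.

Set Implicit Arguments.
Unset Strict Implicit.
Unset Printing Implicit Defensive.

Local Open Scope classical_set_scope.
Local Open Scope group_scope.

(** The group [G] of [R = Rclass s] acts on [R] from the left: freely, because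
    an element of [G] is determined by the image of a single point of [R]
    (right multiplication reaches all the others and commutes with [G]), and
    with the H-classes as orbits. Hence [G] acts freely on the Schuetzenberger
    graph of [R], the labelled digraph with an edge from [x] to [x * a]
    whenever [a] is a generator of [S] and both ends lie in [R], and the
    quotient is a finite graph with one vertex per H-class. Gluing to the
    graph a 2-cell for each defining relation [u = v] of [S] at each vertex
    [x] with [x * u] in [R] adds finitely many orbits of cells. If the
    resulting complex is simply connected, [G] is the fundamental group of a
    finite complex, so it is finitely presented.

    Simple connectedness is where the idempotent enters. The graph is strongly
    connected, so it is enough to contract directed closed paths, and such a
    path at [s] spells a word [w] with [s * w = s], hence [e * w = e]. If the
    word [V] spells [e], then [V w] is turned into [V] by finitely many
    applications of the relations of [S]. As [e * e = e] also
    [s * e = s], so all the intermediate words spell closed paths at [s] and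
    each application crosses a 2-cell. Thus [V w] and [V] are homotopic, and
    [w] is contractible ([loop_label]).

    The argument is carried out inside the presentation read off the quotient
    complex. Choose a representative [r i] of each H-class. The generator
    [gen i a] stands for the unique [g] in [G] with [r i * a = g (r j)], and
    [label i w] is the word in these generators read along the path from [r i]
    spelling [w]. As a relation of [S] at [g (r i)] is the translate of the
    one at [r i], the relators compare [label i u] with [label i v], kill
    the labels of chosen paths to the representatives, and kill the generators
    whose edge leaves [R]. Each group word is then congruent to the label of
    a path from [r i0] to a point of its own H-class ([word_cycle]): formal
    inverses are avoidable because such a path can be continued to a closed
    one, which is contractible. Two such labels with the same value in [G] are
    congruent by the same contractibility ([cycle_label_inj]).

    For regular [s], say [s * t * s = s], the idempotent is [t * s]: it is a
    left multiple of [s] and [s] of it, so they identify the same pairs of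
    right multipliers. Comparing the multipliers [u] and 1 turns such an
    L*-relation into equality of right stabilizers. *)

(** * Green's relations and right stabilizers *)

Section Green.
Variable S : semigroupType.
Implicit Types s t e x y z : S.

Lemma greenLP x y :
  greenL x y <-> (exists u, u * in1 x = in1 y) /\ (exists v, v * in1 y = in1 x).
Proof.
split=> [xy | [[u ux] [v vy]]].
  split.
    have: [set w * in1 y | w in [set: adj1 S]] (in1 y) by exists 1; rewrite ?mul1g.
    by rewrite -xy => -[u _ ux]; exists u.
  have: [set w * in1 x | w in [set: adj1 S]] (in1 x) by exists 1; rewrite ?mul1g.
  by rewrite xy => -[v _ vy]; exists v.
apply/seteqP; split=> _ [w _ <-].
  by exists (w * v) => //; rewrite -mulgA vy.
by exists (w * u) => //; rewrite -mulgA ux.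
Qed.

Lemma greenR_sym x y : greenR x y -> greenR y x.
Proof. by rewrite /greenR => ->. Qed.

Lemma greenR_trans x y z : greenR x y -> greenR y z -> greenR x z.
Proof. by rewrite /greenR => ->. Qed.

Lemma HclassP x y : greenH x y <-> Hclass x = Hclass y.
Proof.
split=> [[xLy xRy]|xy]; last by have : Hclass y y by []; rewrite -xy.
apply/seteqP.
by split=> z [zL zR]; split; rewrite /greenL /greenR ?xLy ?xRy // -?xLy -?xRy.
Qed.

(** Left multiplication by [w] carries [u t = u] to [(w u) t = w u], so right
    stabilizers are monotone along left divisibility. *)
Lemma rstab_greenL x y : greenL x y -> rstab x = rstab y.
Proof.
suff sub (u v : S) : greenL u v -> rstab u `<=` rstab v.
  move=> xy; apply/seteqP; split; first exact: sub.
  by apply: sub; rewrite /greenL xy.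
move=> uv t ut; have [[w wu] _] := (greenLP _ _).1 uv; apply: in1_inj.
by rewrite [RHS](esym wu) -[in RHS]ut -[LHS]/(in1 v * in1 t) -wu -mulgA.
Qed.

Lemma rstab_Lstar x y : Lstar x y -> rstab x = rstab y.
Proof.
move=> xy; apply/seteqP; split=> t xt.
  by have [+ _] := xy (in1 t) 1 => /(_ (congr1 (@in1 S) xt)) [].
by have [_ +] := xy (in1 t) 1 => /(_ (congr1 (@in1 S) xt)) [].
Qed.

Lemma regular_Lstar_idempotent s :
  is_regular s -> exists e, is_idempotent e /\ Lstar s e.
Proof.
move=> [t sts]; exists (t * s); split.
  by rewrite /is_idempotent -[LHS]mulgA [s * _]mulgA sts.
have E w : in1 (t * s) * w = in1 t * (in1 s * w) by rewrite mulgA.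
move=> u v; rewrite !E; split=> [-> //|eq_uv].
(* Recover [s * w] from [t * s * w] by multiplying with [s]. *)
have K w : in1 s * w = in1 s * (in1 t * (in1 s * w)).
  by rewrite !mulgA -!gmulfM sts.
by rewrite K eq_uv -K.
Qed.

End Green.

(** * The free left action of the group on the R-class *)

(** Supplies representatives of the H-classes. The index [c] is a function of
    the value [f x], so it is constant on the fibres of [f] by construction. *)
Lemma finite_image_transversal (T : Type) (U : choiceType) (A : set T)
    (f : T -> U) : A !=set0 -> finite_set (f @` A) ->
  exists k (r : 'I_k -> T) (c : U -> 'I_k),
    [/\ forall i, A (r i), forall i, c (f (r i)) = i &
        forall x, A x -> f (r (c (f x))) = f x].
Proof.
move=> [x0 Ax0] /finite_seqP [l0 fA].
pose l := undup l0.
have memP z : A z -> f z \in l.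
  by move=> Az; rewrite mem_undup; have : (f @` A) (f z) by [exists z]; rewrite fA.
have rP (i : 'I_(size l)) : exists2 x, A x & f x = tnth (in_tuple l) i.
  have : tnth (in_tuple l) i \in l by exact: mem_tnth.
  by rewrite mem_undup => li; have : [set` l0] (tnth (in_tuple l) i) by []; rewrite -fA.
have l_gt0 : (index (f x0) l < size l)%N by rewrite index_mem memP.
exists (size l), (fun i => projT1 (cid2 (rP i))).
exists (fun z => insubd (Ordinal l_gt0) (index z l)); split.
- by move=> i; case: cid2.
- move=> i; case: cid2 => x /= _ ->; apply: val_inj.
  rewrite val_insubd (tnth_nth (f x0)) /= index_uniq ?undup_uniq ?ltn_ord //.
- move=> x Ax; case: cid2 => y /= _ ->.
  by rewrite (tnth_nth (f x0)) val_insubd /= index_mem memP // nth_index ?memP.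
Qed.

Section SchutzenbergerAction.
Variables (S : semigroupType) (s : S) (fin : finite_set (Hclasses (Rclass s))).
Local Notation R := (Rclass s).
Local Notation G := (schutz_group fin).
Implicit Types (g h : G) (x y a : S).

(** Written on [S] itself: the only element of [S^1] outside [S] is the
    adjoined identity, which acts trivially. Outside of [R] the value depends on
    the choice of a representative of [g]. *)
Definition lact g x : S :=
  if val (repr (g : schutz_monoid R)) is Some a then a * x else x.

Lemma in1_lact g x : in1 (lact g x) = val (repr (g : schutz_monoid R)) * in1 x.
Proof. by rewrite /lact; case: (val _). Qed.

Lemma lactA g x a : lact g (x * a) = lact g x * a.
Proof. by rewrite /lact; case: (val _) => [b|] //; rewrite mulgA. Qed.

Lemma lact_R g x : R x -> R (lact g x).
Proof.
move=> Rx; have : St R (val (repr (g : schutz_monoid R))) by apply/set_mem; exact: valP.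
move=> /(_ (val (repr (g : schutz_monoid R)) * in1 x)) []; first by exists x.
by move=> y Ry; rewrite -in1_lact => /in1_inj <-.
Qed.

Lemma pi_lact (u : St_type R) x :
  R x -> in1 (lact (\pi_(schutz_monoid R)%qT u : G) x) = val u * in1 x.
Proof. by rewrite in1_lact; move: x; apply/schutz_piP; rewrite reprK. Qed.

Lemma lact1 x : R x -> lact 1 x = x.
Proof. by move=> Rx; apply: in1_inj; rewrite (pi_lact 1 Rx) val1 mul1g. Qed.

Lemma lactM g h x : R x -> lact (g * h) x = lact g (lact h x).
Proof.
move=> Rx; apply: in1_inj.
by rewrite (pi_lact (repr (g : schutz_monoid R) * repr (h : schutz_monoid R)) Rx)
  !in1_lact valM mulgA.
Qed.

(** Every point of [R] is [x * v] for some [v], and left multiplications commute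
    with right ones. *)
Lemma lact_free g h x : R x -> lact g x = lact h x -> g = h.
Proof.
move=> Rx ghx; rewrite -[g]reprK -[h]reprK; apply/schutz_piP => y Ry.
have [[v <-] _] := (greenRP _ _).1 (greenR_trans (greenR_sym Rx) Ry).
by rewrite !mulgA -!in1_lact ghx.
Qed.

Lemma lact_greenH g x : R x -> greenH (lact g x) x.
Proof.
move=> Rx; split; last exact: greenR_trans (greenR_sym (lact_R g Rx)) Rx.
apply/greenLP; split; last by exists (val (repr (g : schutz_monoid R))); rewrite in1_lact.
exists (val (repr (g^-1 : schutz_monoid R))).
by rewrite -in1_lact -lactM // mulVg lact1.
Qed.

(** If [u * x = y] with [y] in [R], then [u] preserves [R]: for [x = r * v] and
    [r = x * v'] one has [u * r = y * v'], and [v] leads back to [y]. *)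
Lemma greenH_lact x y : R x -> greenH x y -> exists g, lact g x = y.
Proof.
move=> Rx [xLy xRy]; have [[u ux] _] := (greenLP _ _).1 xLy.
suff uR : u \in St R.
  by exists (\pi_(schutz_monoid R)%qT (Sub u uR)); apply: in1_inj; rewrite pi_lact ?SubK.
apply/mem_set => _ [r Rr <-].
have [[v rv] [v' vr]] := (greenRP _ _).1 (greenR_trans (greenR_sym Rr) Rx).
have ur : u * in1 r = in1 y * v' by rewrite -vr mulgA ux.
have [z zE] : exists z, in1 z = u * in1 r by case: (u) => [a|]; [exists (a * r)|exists r].
exists z => //; apply: greenR_trans Rx (greenR_trans xRy _).
by apply/greenRP; split; [exists v'|exists v]; rewrite zE -?ur // -mulgA rv.
Qed.

End SchutzenbergerAction.

(** * Right action of words *)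

Section WordAction.
Variables (S : semigroupType) (n : nat).
Variable phi : {multiplicative free_semigroup 'I_n -> S}.
Implicit Types (x y : S) (u v w : seq 'I_n).

Definition letter (a : 'I_n) : free_semigroup 'I_n :=
  Sub ([:: a] : free_monoid 'I_n) isT.

Definition ract x w : S := foldl (fun y a => y * phi (letter a)) x w.

Lemma ract_cat x u v : ract x (u ++ v) = ract (ract x u) v.
Proof. exact: foldl_cat. Qed.

Lemma ract_val x (W : free_semigroup 'I_n) : ract x (val W) = x * phi W.
Proof.
case: W => -[//|a w] nz /=; elim: w x a nz => [|b w IH] x a nz.
  by rewrite /ract /=; congr (_ * phi _); apply: val_inj.
have nz' : (b :: w : free_monoid 'I_n) != 1 by [].
rewrite [LHS](IH _ _ nz') -mulgA -gmulfM.
by congr (_ * phi _); apply: val_inj.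
Qed.

Lemma ract_mul w : exists u : adj1 S, forall y, (in1 (ract y w) = in1 y * u).
Proof.
case: w => [|a w]; first by exists 1 => y; rewrite mulg1.
have nz : (a :: w : free_monoid 'I_n) != 1 by [].
exists (in1 (phi (Sub (a :: w : free_monoid 'I_n) nz))) => y.
by rewrite -gmulfM -ract_val.
Qed.

Lemma ract_realizes (u : adj1 S) : (forall z, exists W, phi W = z) ->
  exists w, forall y, in1 (ract y w) = in1 y * u.
Proof.
move=> surj; case: u => [z|]; last by exists [::].
by have [W <-] := surj z; exists (val W) => y; rewrite ract_val.
Qed.

End WordAction.

(** * Trivial factors modulo a congruence *)

Lemma congr_mul1l (F : monoidType) (E : F -> F -> Prop) (x y : F) :
  congr_gen E x 1 -> congr_gen E (x * y) y.
Proof.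
by move=> x1; rewrite -[X in congr_gen _ _ X]mul1g; exact: (congr_mul x1 (congr_refl _ _)).
Qed.

Lemma congr_mul1r (F : monoidType) (E : F -> F -> Prop) (x y : F) :
  congr_gen E y 1 -> congr_gen E (x * y) x.
Proof.
by move=> y1; rewrite -[X in congr_gen _ _ X]mulg1; exact: (congr_mul (congr_refl _ _) y1).
Qed.

(** * The quotient of the Schuetzenberger graph *)

Section SchutzenbergerPresentation.
Variables (S : semigroupType) (s : S) (fin : finite_set (Hclasses (Rclass s))).
Local Notation R := (Rclass s).
Local Notation G := (schutz_group fin).

Variables (n : nat) (E : seq (free_semigroup 'I_n * free_semigroup 'I_n)).
Variable phi : {multiplicative free_semigroup 'I_n -> S}.
Hypothesis phi_presents : presents (fun u v => (u, v) \in E) phi.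
Local Notation ract := (ract phi).

(* The vertices of the quotient graph: [r i] represents the i-th H-class of
   [R], and [c x] is the index of the H-class of [x]. *)
Variables (k : nat) (r : 'I_k -> S) (c : S -> 'I_k).
Hypotheses (rR : forall i, R (r i)) (cK : forall i, c (r i) = i).
Hypothesis c_greenH : forall x y, greenH x y -> c x = c y.
Hypothesis greenH_c : forall x, R x -> greenH (r (c x)) x.

Implicit Types (x y : S) (i j : 'I_k) (a : 'I_n) (w : seq 'I_n).

(** A path that ends in [R] never leaves it before: each vertex on it is a right
    multiple of the first and has the last as a right multiple. *)
Lemma ract_R_prefix x u v : R x -> R (ract x (u ++ v)) -> R (ract x u).
Proof.
rewrite ract_cat => Rx Rxuv; apply: (greenR_trans Rx).
have [U UE] := ract_mul phi u; have [V VE] := ract_mul phi v.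
have [_ [t tE]] := (greenRP _ _).1 (greenR_trans (greenR_sym Rx) Rxuv).
apply/greenRP; split; first by exists U.
by exists (V * t); rewrite mulgA -VE.
Qed.

Lemma ract_connected x y : R x -> R y -> exists w, ract x w = y.
Proof.
move=> Rx Ry.
have [[u ux] _] := (greenRP _ _).1 (greenR_trans (greenR_sym Rx) Ry).
have [w wE] := ract_realizes u phi_presents.1.
by exists w; apply: in1_inj; rewrite wE.
Qed.

Lemma ract_lact (g : G) x w : ract (lact g x) w = lact g (ract x w).
Proof. by elim: w x => //= a w IH x; rewrite -lactA IH. Qed.

Lemma ract_R_lact (g : G) x w : R x -> R (ract (lact g x) w) -> R (ract x w).
Proof.
move=> Rx Rgw; have [U UE] := ract_mul phi w; apply: (greenR_trans Rx).
have [_ [t tE]] := (greenRP _ _).1 (greenR_trans (greenR_sym (lact_R g Rx)) Rgw).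
apply/greenRP; split; [by exists U | exists t].
have xE : in1 x = val (repr (g^-1 : schutz_monoid R)) * in1 (lact g x).
  by rewrite -in1_lact -lactM // mulVg lact1.
by rewrite UE {1}xE -!mulgA [in1 _ * _]mulgA -UE tE -xE.
Qed.

(** Edges that leave [R] are kept, with a meaningless target, so that labels
    are total functions of the word; [edge_weight] sends them to 1. *)
Definition next i a : 'I_k := c (r i * phi (letter a)).
Definition state i w : 'I_k := foldl next i w.

Definition ngens : nat := #|{: 'I_k * 'I_n}|.
Local Notation word := (group_word ngens).

Definition gen i a : word := [:: (enum_rank (i, a), true)].

Fixpoint label i w : word :=
  if w is a :: w' then gen i a * label (next i a) w' else 1.

Lemma state_cat i u v : state i (u ++ v) = state (state i u) v.
Proof. exact: foldl_cat. Qed.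

Lemma label_cat i u v : label i (u ++ v) = label i u * label (state i u) v.
Proof. by elim: u i => [|a u IH] i; rewrite ?mul1g //= IH mulgA. Qed.

Lemma edge_weight_ex i a : exists g : G,
  let x := r i * phi (letter a) in
  (R x -> lact g (r (next i a)) = x) /\ (~ R x -> g = 1).
Proof.
have [Rx|nRx] := pselect (R (r i * phi (letter a))); last by exists 1.
have [g gE] := greenH_lact fin (rR _) (greenH_c Rx).
by exists g.
Qed.

Definition edge_weight i a : G := projT1 (cid (edge_weight_ex i a)).

Lemma edge_weightP i a : R (r i * phi (letter a)) ->
  lact (edge_weight i a) (r (next i a)) = r i * phi (letter a).
Proof. by rewrite /edge_weight; case: cid => g []. Qed.

Lemma edge_weight1 i a : ~ R (r i * phi (letter a)) -> edge_weight i a = 1.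
Proof. by rewrite /edge_weight; case: cid => g []. Qed.

Definition eval_letter (l : 'I_ngens * bool) : G :=
  let g := edge_weight (enum_val l.1).1 (enum_val l.1).2 in
  if l.2 then g else g^-1.

Definition eval (u : word) : G := foldr (fun l g => eval_letter l * g) 1 u.

Lemma evalM : {morph eval : u v / u * v}.
Proof. by elim=> [|l u IH] v; rewrite ?mul1g //= -mulgA -IH. Qed.

HB.instance Definition _ := isMultiplicative.Build word G eval evalM.

Lemma eval_gen i a : eval (gen i a) = edge_weight i a.
Proof. by rewrite /eval /= mulg1 /eval_letter enum_rankK. Qed.

(** The label of a path measures the displacement of its endpoint from the
    representative of the same H-class. Hence labels of closed paths have value
    1, and the value determines the endpoint. *)
Lemma lact_label i w : R (ract (r i) w) ->
  lact (eval (label i w)) (r (state i w)) = ract (r i) w.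
Proof.
elim: w i => [|a w IH] i Rw; first by rewrite lact1.
have Ra : R (r i * phi (letter a)) by exact: (@ract_R_prefix _ [:: a] w).
have aE := edge_weightP Ra.
have wE : ract (r i) (a :: w) = lact (edge_weight i a) (ract (r (next i a)) w).
  by rewrite -ract_lact aE.
have Rw' : R (ract (r (next i a)) w).
  by apply: (@ract_R_lact (edge_weight i a)); rewrite ?aE.
by rewrite [label _ _]/= evalM eval_gen lactM ?rR // IH // wE.
Qed.

Lemma state_c i w : R (ract (r i) w) -> state i w = c (ract (r i) w).
Proof.
move=> Rw; rewrite -[LHS]cK; apply/esym/c_greenH.
by rewrite -lact_label //; apply: lact_greenH.
Qed.

(** * The relators *)

(* A base vertex and a path from it to each representative. *)
Variables (i0 : 'I_k) (tree : 'I_k -> seq 'I_n).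
Hypothesis treeP : forall i, ract (r i0) (tree i) = r i.

Lemma state_tree i : state i0 (tree i) = i.
Proof. by rewrite state_c treeP. Qed.

Definition cell_relators : seq (word * word) :=
  [seq (label i (val uv.1), label i (val uv.2)) | i <- enum 'I_k,
     uv <- [seq uv <- E | `[< R (r i * phi uv.1) >]]].
Definition tree_relators : seq (word * word) :=
  [seq (label i0 (tree i), 1) | i <- enum 'I_k].
Definition dead_relators : seq (word * word) :=
  [seq (gen ia.1 ia.2, 1) | ia <- enum {: 'I_k * 'I_n} &
     `[< ~ R (r ia.1 * phi (letter ia.2)) >]].
Definition relators := cell_relators ++ tree_relators ++ dead_relators.

Local Notation "u =~ v" :=
  (congr_gen (fun x y : word => (x, y) \in relators \/ free_cancel x y) u v)
  (at level 70).

Lemma cell_congr i u v : (u, v) \in E -> R (r i * phi u) ->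
  label i (val u) =~ label i (val v).
Proof.
move=> uvE Ru; apply: congr_base; left; rewrite !mem_cat; apply/or3P/Or31.
apply/allpairsPdep; exists i, (u, v); split=> //; first by rewrite mem_enum.
by rewrite mem_filter uvE andbT; apply/asboolP.
Qed.

Lemma tree_congr i : label i0 (tree i) =~ 1.
Proof.
apply: congr_base; left; rewrite !mem_cat; apply/or3P/Or32.
by apply/mapP; exists i; rewrite ?mem_enum.
Qed.

Lemma dead_congr i a : ~ R (r i * phi (letter a)) -> gen i a =~ 1.
Proof.
move=> nR; apply: congr_base; left; rewrite !mem_cat; apply/or3P/Or33.
by apply/mapP; exists (i, a); rewrite // mem_filter mem_enum andbT; apply/asboolP.
Qed.

(** All relators hold in [G]: two paths with the same ends have labels with the
    same displacement, and the action is free. *)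
Lemma eval_congr (u v : word) : u =~ v -> eval u = eval v.
Proof.
elim=> {u v} [u v uv|//|//|u v w _ -> _ ->|u u' v v' _ uu' _ vv'] //; last first.
  by rewrite !evalM uu' vv'.
case: uv; last first.
  by case=> i [] /=; rewrite mulg1 /eval_letter /= ?mulgV ?mulVg.
rewrite !mem_cat => /or3P[/allpairsPdep|/mapP|/mapP].
- move=> [i [[U V] [_ + [-> ->]]]]; rewrite mem_filter => /andP[/asboolP /= RU UV].
  have phiUV : phi U = phi V by apply/phi_presents.2; exact: congr_base.
  have UVr : ract (r i) (val U) = ract (r i) (val V) by rewrite !ract_val phiUV.
  have RU' : R (ract (r i) (val U)) by rewrite ract_val.
  have RV' : R (ract (r i) (val V)) by rewrite -UVr.
  apply: (lact_free (rR (state i (val U)))).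
  rewrite lact_label // UVr (state_c RU') UVr -state_c //.
  exact: esym (lact_label RV').
- move=> [i _ [-> ->]]; apply: (lact_free (rR i)).
  have := @lact_label i0 (tree i); rewrite state_tree treeP => -> //.
  by rewrite [RHS]lact1.
- move=> [[i a] + [-> ->]] /=; rewrite mem_filter => /andP[/asboolP /= nR _].
  exact: etrans (eval_gen i a) (edge_weight1 nR).
Qed.

(** Crossing 2-cells: a derivation of [u = v] in [S] can be replayed from any
    [r i] for which the path [u] stays in [R]. *)
Lemma label_congr u v i : congr_gen (fun u v => (u, v) \in E) u v ->
  R (r i * phi u) -> label i (val u) =~ label i (val v).
Proof.
have phiE U V : congr_gen (fun u v => (u, v) \in E) U V -> phi U = phi V.
  by move/phi_presents.2.
move=> uv; elim: uv i => {u v} [u v uvE i|u i _|u v uv IH i|u v w uv IHu vw IHv i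
    |u u' v v' uu' IHu vv' IHv i].
- exact: cell_congr.
- exact: congr_refl.
- by rewrite -(phiE _ _ uv) => /IH; exact: congr_sym.
- move=> Ru; apply: congr_trans (IHu _ Ru) (IHv _ _).
  by rewrite -(phiE _ _ uv).
rewrite gmulfM mulgA => Ruv.
have Ru : R (ract (r i) (val u)).
  by apply: (@ract_R_prefix _ _ (val v)); rewrite // ract_cat !ract_val.
have uE : ract (r i) (val u) = ract (r i) (val u').
  by rewrite !ract_val (phiE _ _ uu').
have Ru' : R (ract (r i) (val u')) by rewrite -uE.
rewrite -[val (u * v)]/(val u ++ val v) -[val (u' * v')]/(val u' ++ val v') !label_cat.
apply: congr_mul; first by apply: IHu; rewrite -ract_val.
rewrite (state_c Ru') -uE -state_c //; apply: IHv; rewrite -ract_val.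
apply: (@ract_R_lact (eval (label i (val u)))) => //.
by rewrite lact_label // !ract_val.
Qed.

(** * Contractibility of closed paths *)

Lemma word_linv (u : word) : exists v, v * u =~ 1.
Proof.
elim: u => [|[i b] u [v vu]]; first by exists 1; exact: congr_refl.
exists (v * [:: (i, ~~ b)]); apply: congr_trans vu.
have -> : v * [:: (i, ~~ b)] * ((i, b) :: u) = v * (([:: (i, ~~ b); (i, b)] : word) * u).
  by rewrite -mulgA.
apply: congr_mul; first exact: congr_refl.
apply: congr_mul1l; apply: congr_base; right.
by have := FreeCancel i (~~ b); rewrite negbK.
Qed.

Lemma word_cancel1 (u v : word) : u * v =~ u -> v =~ 1.
Proof.
move=> uvu; have [t tu] := word_linv u.
apply: congr_trans (congr_sym (congr_mul1l v tu)) _; rewrite -mulgA.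
exact: congr_trans (congr_mul (congr_refl _ t) uvu) tu.
Qed.

Variable e : S.
Hypothesis e_rstab : rstab (r i0) = rstab e.
Hypothesis ee : is_idempotent e.

(** The complex is simply connected. With [V] a word for [e], the path [V] is
    closed at [r i0], and [V w] is derivable from [V]. *)
Lemma loop_label w : ract (r i0) w = r i0 -> label i0 w =~ 1.
Proof.
case: w => [|a w]; first by move=> _; exact: congr_refl.
have nz : (a :: w : free_monoid 'I_n) != 1 by [].
pose W : free_semigroup 'I_n := Sub (a :: w : free_monoid 'I_n) nz.
rewrite -[a :: w]/(val W) ract_val => W_stab.
have [V VE] := phi_presents.1 e.
have rV : r i0 * phi V = r i0.
  by rewrite VE; have : rstab e e by []; rewrite -e_rstab.
have eW : e * phi W = e by have : rstab (r i0) (phi W) by []; rewrite e_rstab.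
have VW : congr_gen (fun u v => (u, v) \in E) (V * W) V.
  by apply/phi_presents.2; rewrite gmulfM VE.
have V_state : state i0 (val V) = i0 by rewrite state_c ract_val rV.
apply: (@word_cancel1 (label i0 (val V))).
rewrite -{2}V_state -label_cat.
by apply: (label_congr VW); rewrite gmulfM mulgA rV W_stab.
Qed.

(** * Labels of cycles exhaust the presented group *)

(** Paths whose image in the quotient graph is closed, that is, those from
    [r i0] to a point of its orbit. *)
Definition cycle w := R (ract (r i0) w) /\ state i0 w = i0.

Lemma cycleE w : cycle w -> ract (r i0) w = lact (eval (label i0 w)) (r i0).
Proof. by move=> [Rw w0]; rewrite -lact_label // w0. Qed.

(** The path spells a word that leads from [r i0] to [g (r i0)]. *)
Lemma cycle_of_eval (g : G) : exists2 w, cycle w & eval (label i0 w) = g.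
Proof.
have Rg := lact_R g (rR i0).
have [w wE] := ract_connected (rR i0) Rg.
have wc : cycle w.
  split; first by rewrite wE.
  by rewrite state_c wE // (c_greenH (lact_greenH _ _)).
by exists w => //; apply: (lact_free (rR i0)); rewrite -cycleE.
Qed.

Lemma cycle_cat u v : cycle u -> cycle v -> cycle (u ++ v).
Proof.
move=> cu [Rv v0]; split; last by rewrite state_cat cu.2.
by rewrite ract_cat cycleE // ract_lact; exact: lact_R.
Qed.

Lemma cycle_trivial w : cycle w -> eval (label i0 w) = 1 -> label i0 w =~ 1.
Proof. by move=> cw w1; apply: loop_label; rewrite cycleE // w1 lact1. Qed.

Lemma cycle_mul_trivial u v : cycle u -> cycle v ->
  eval (label i0 u) * eval (label i0 v) = 1 -> label i0 u * label i0 v =~ 1.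
Proof.
move=> cu cv uv1.
have catE : label i0 (u ++ v) = label i0 u * label i0 v by rewrite label_cat cu.2.
by rewrite -catE; apply: cycle_trivial; rewrite ?catE ?evalM //; exact: cycle_cat.
Qed.

(** Insert a cycle [t] whose value is inverse to the common one: [u t] and [t v]
    lift to closed paths. *)
Lemma cycle_label_inj u v : cycle u -> cycle v ->
  eval (label i0 u) = eval (label i0 v) -> label i0 u =~ label i0 v.
Proof.
move=> cu cv uv; have [t ct tE] := cycle_of_eval (eval (label i0 v))^-1.
apply: (@congr_trans _ _ _ (label i0 u * (label i0 t * label i0 v))).
  apply: congr_sym; apply: congr_mul1r.
  by apply: cycle_mul_trivial; rewrite // tE mulVg.
rewrite mulgA; apply: congr_mul1l.
by apply: cycle_mul_trivial; rewrite // tE uv mulgV.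
Qed.

(** With the chosen path to [r j] in front, [q] completes a closed path. *)
Lemma tree_return_congr j q : ract (r j) q = r i0 -> label j q =~ 1.
Proof.
move=> qE; apply: (@congr_trans _ _ _ (label i0 (tree j ++ q))).
  rewrite label_cat state_tree; apply: congr_sym.
  by apply: congr_mul1l; exact: tree_congr.
by apply: loop_label; rewrite ract_cat treeP.
Qed.

(** If the edge lies in [R], the cycle goes to [r i] along its chosen path,
    follows the edge, and returns to the base by any path: only the edge
    contributes to the label. Otherwise the generator is a relator and the
    empty cycle serves. *)
Lemma gen_cycle i a : exists2 w, cycle w & gen i a =~ label i0 w.
Proof.
have [Ra|nRa] := pselect (R (r i * phi (letter a))); last first.
  exists [::]; first by split=> //; exact: rR.
  exact: dead_congr.
have [q qE] := ract_connected (rR (next i a)) (rR i0).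
have wE : ract (r i0) (tree i ++ a :: q) = lact (edge_weight i a) (r i0).
  by rewrite ract_cat treeP -qE -ract_lact edge_weightP.
have Rw := lact_R (edge_weight i a) (rR i0); rewrite -wE in Rw.
exists (tree i ++ a :: q).
  by split; rewrite // state_c // wE (c_greenH (lact_greenH _ _)).
rewrite label_cat state_tree; apply: congr_sym.
apply: congr_trans (congr_mul1l _ (tree_congr i)) _.
by apply: congr_mul1r; exact: tree_return_congr.
Qed.

(** A formal inverse is congruent to the label of a cycle that undoes the cycle
    of the generator. *)
Lemma letter_cycle (l : 'I_ngens * bool) :
  exists2 w, cycle w & ([:: l] : word) =~ label i0 w.
Proof.
case: l => x b; rewrite -[x]enum_valK; case: (enum_val x) => i a.
have [w cw wE] := gen_cycle i a; case: b; first by exists w.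
have [v cv vE] := cycle_of_eval (eval (label i0 w))^-1; exists v => //.
pose x' : word := [:: (enum_rank (i, a), false)].
apply: (@congr_trans _ _ _ (x' * (label i0 w * label i0 v))).
  apply: congr_sym; apply: congr_mul1r.
  by apply: cycle_mul_trivial; rewrite // vE mulgV.
rewrite mulgA; apply: congr_mul1l.
apply: (@congr_trans _ _ _ (x' * gen i a)).
  by apply: congr_mul; [exact: congr_refl | exact: congr_sym].
by apply: congr_base; right; exact: (FreeCancel _ false).
Qed.

Lemma word_cycle (u : word) : exists2 w, cycle w & u =~ label i0 w.
Proof.
elim: u => [|l u [w cw uw]].
  by exists [::]; [split=> //; exact: rR | exact: congr_refl].
have [v cv lv] := letter_cycle l.
exists (v ++ w); first exact: cycle_cat.
by rewrite label_cat cv.2; apply: (congr_mul lv uw).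
Qed.

Lemma relators_present :
  presents (fun u v => (u, v) \in relators \/ free_cancel u v)
    (eval : {multiplicative word -> G}).
Proof.
split=> [g|u v]; first by have [w _ wE] := cycle_of_eval g; exists (label i0 w).
split=> [uv|]; last exact: eval_congr.
have [w cw uw] := word_cycle u; have [t ct vt] := word_cycle v.
apply: (congr_trans uw (congr_trans _ (congr_sym vt))).
by apply: cycle_label_inj; rewrite // -(eval_congr uw) -(eval_congr vt).
Qed.

End SchutzenbergerPresentation.

Theorem corollary1p2 (S : semigroupType) (s : S) :
  (forall fin : finite_set (Hclasses (Rclass s)),
     fin_presented_semigroup S ->
     (exists e : S, is_idempotent e /\ rstab s = rstab e) ->
     fin_presented_group (schutz_group fin)) /\
  (is_regular s -> exists e : S, is_idempotent e /\ rstab s = rstab e) /\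
  ((exists e : S, is_idempotent e /\ Lstar s e) ->
     exists e : S, is_idempotent e /\ rstab s = rstab e) /\
  (is_regular s -> exists e : S, is_idempotent e /\ Lstar s e).
Proof.
have Lstar_case : (exists e : S, is_idempotent e /\ Lstar s e) ->
    exists e : S, is_idempotent e /\ rstab s = rstab e.
  by move=> [e [ee /rstab_Lstar se]]; exists e.
split; last first.
  split; first by move=> /regular_Lstar_idempotent.
  by split=> // /regular_Lstar_idempotent.
move=> fin [n [E [phi phi_presents]]] [e [ee se]].
have Rs : Rclass s s by [].
have [|k [r [c [rR cK rc]]]] := finite_image_transversal _ fin; first by exists s.
pose cl x := c (Hclass x); pose i0 := cl s.
have cl_greenH x y : greenH x y -> cl x = cl y.
  by move=> /HclassP xy; rewrite /cl xy.
have greenH_cl x : Rclass s x -> greenH (r (cl x)) x.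
  by move=> Rx; apply/HclassP; exact: rc.
have [tree treeP] := choice (fun i => ract_connected phi_presents (rR i0) (rR i)).
have i0_rstab : rstab (r i0) = rstab e.
  by rewrite -se; apply: rstab_greenL; have [] := greenH_cl s Rs.
exists (ngens n k), (relators s E phi r cl i0 tree), (eval fin phi rR greenH_cl).
exact: (@relators_present _ _ fin _ _ _ phi_presents _ _ _ rR cK cl_greenH
  greenH_cl _ _ treeP _ i0_rstab ee).
Qed.
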